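(* For every positive integer $k$ there is a constant $c>0$, depending on $k$ only, such that the following holds: let $K$ be a field of characteristic different from $2$, let $n$ be a positive integer, and let $\mathcal{M}_1,\mathcal{M}_2$ be two $n$-element sets of $k\times k$ matrices over $K$. If the bipartite graph $G(\mathcal{M}_1,\mathcal{M}_2)$ contains a perfect matching (that is, $n$ vertex disjoint edges), then it has at least $cn^2$ edges.
   Context: For two (not necessarily disjoint) sets $\mathcal{M}_1,\mathcal{M}_2$ of $k\times k$ matrices over a field $K$, $G(\mathcal{M}_1,\mathcal{M}_2)$ denotes the bipartite graph whose two vertex classes are (copies of) $\mathcal{M}_1$ and $\mathcal{M}_2$ (a matrix belonging to both sets gives one vertex in each class), where $A\in\mathcal{M}_1$ and $B\in\mathcal{M}_2$ are connected by an edge if and only if $\det(A+B)\neq 0$. The matrices in $\mathcal{M}_1$ and $\mathcal{M}_2$ are not assumed to be nonsingular. A matching in a graph is a set of vertex disjoint edges. *)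

(* Defs.v *)
From HB Require Import structures.
From mathcomp Require Import all_boot all_order all_algebra.
From mathcomp Require Import finmap reals.

Set Implicit Arguments.
Unset Strict Implicit.
Unset Printing Implicit Defensive.

Import GRing.Theory.
Local Open Scope ring_scope.

(* A graph on V is given by its adjacency relation (symmetric and irreflexive
   in the intended use); an edge is the two-element set of its endpoints. *)
Definition edges (V : finType) (e : rel V) : {set {set V}} :=
  [set [set p.1; p.2] | p in [pred p : V * V | e p.1 p.2]].

Definition matching (V : finType) (e : rel V) (S : {set {set V}}) : bool :=
  (S \subset edges e) && trivIset S.

Section DetGraph.

Variables (K : fieldType) (k : nat) (M1 M2 : {fset 'M[K]_k}).

(* A disjoint sum, so that a matrix in both M1 and M2 gives two vertices. *)
Definition det_vertex : finType := (M1 + M2)%type.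

Definition det_graph : rel det_vertex := fun u v =>
  match u, v with
  | inl A, inr B => \det (fsval A + fsval B) != 0
  | inr B, inl A => \det (fsval A + fsval B) != 0
  | _, _ => false
  end.

Lemma det_graph_sym : symmetric det_graph.
Proof. by case=> [A|A] [B|B]. Qed.

Lemma det_graph_irr : irreflexive det_graph.
Proof. by case. Qed.

Lemma perfect_matchingE (n : nat) (S : {set {set det_vertex}}) :
  #|` M1| = n -> #|` M2| = n -> matching det_graph S ->
  (#|S| == n) = (cover S == [set: det_vertex]).
Proof.
move=> h1 h2 /andP[/subsetP sS tS].
have card2 A : A \in S -> #|A| = 2%N.
  move/sS/imsetP=> [[u v] /= uv ->]; rewrite cards2.
  by case: eqP uv => // <-; rewrite inE /= det_graph_irr.
have cS : #|cover S| = (#|S| * 2)%N.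
  by rewrite -(eqP tS) (eq_bigr (fun=> 2%N)) ?sum_nat_const // => A /card2.
by rewrite eqEcard subsetT cardsT card_sum -!cardfE h1 h2 cS addnn -muln2 leq_mul2r /=
  eqn_leq; apply/andb_idl => _; rewrite -(@leq_pmul2r 2) // -cS
  (leq_trans (max_card _)) // card_sum -!cardfE h1 h2 addnn -muln2.
Qed.

End DetGraph.

Arguments det_graph {K k} M1 M2 _ _.

(* Main.v *)
Require Import Defs.
From HB Require Import structures.
From mathcomp Require Import all_boot all_order all_algebra all_fingroup.
From mathcomp Require Import finmap reals zify.

Import GRing.Theory Num.Theory.
Local Open Scope ring_scope.

(** Let [A_i, B_i] be the matched pairs. Expanding [det (A + B)] by the Leibniz
    formula and multilinearity writes it as a sum of [r = k! 2^k] terms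
    [f A * g B], so every matrix [(det (A_i + B_j))_(i,j)] has rank at most [r].
    Its diagonal entries are nonzero, hence any set of more than [r] indices
    contains [i != j] with [det (A_i + B_j) != 0]. A Turan-type greedy argument
    then gives at least [n^2 / (2r)] nonzero entries, each of which is an edge. *)

(** In each Leibniz product, [t.2] selects the rows that contribute an entry of [A]; padding with 1
    splits every term into a factor in [A] and a factor in [B]. *)
Lemma det_addE (R : comNzRingType) (k : nat) (A B : 'M[R]_k) :
  \det (A + B) = \sum_(t : {perm 'I_k} * {ffun 'I_k -> bool})
    ((-1) ^+ t.1 * \prod_i (if t.2 i then A i (t.1 i) else 1)) *
    \prod_i (if t.2 i then 1 else B i (t.1 i)).
Proof.
rewrite -(pair_big predT predT (fun (s : {perm 'I_k}) (f : {ffun 'I_k -> bool}) =>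
  ((-1) ^+ s * \prod_i (if f i then A i (s i) else 1)) *
  \prod_i (if f i then 1 else B i (s i)))) /=.
apply: eq_bigr => s _.
transitivity ((-1) ^+ s *
    \prod_i \sum_(b : bool) if b then A i (s i) else B i (s i)).
  by congr (_ * _); apply: eq_bigr => i _; rewrite big_bool mxE.
rewrite bigA_distr_bigA big_distrr /=; apply: eq_bigr => f _.
rewrite -mulrA -big_split /=; congr (_ * _); apply: eq_bigr => i _.
by case: (f i); rewrite ?mulr1 ?mul1r.
Qed.

(** Such a matrix is a product whose inner dimension is [#|T|]. *)
Lemma mxrank_sum_mul (F : fieldType) (m n : nat) (T : finType)
    (f : 'I_m -> T -> F) (g : T -> 'I_n -> F) :
  (\rank (\matrix_(i, j) \sum_t f i t * g t j)%R <= #|T|)%N.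
Proof.
have -> : \matrix_(i, j) \sum_t f i t * g t j =
    (\matrix_(i < m, t < #|T|) f i (enum_val t)) *m
    (\matrix_(t < #|T|, j < n) g (enum_val t) j).
  apply/matrixP => i j; rewrite !mxE.
  rewrite (reindex (enum_val : 'I_#|T| -> T)) /=; last first.
    by apply: onW_bij; apply: enum_val_bij.
  by apply: eq_bigr => t _; rewrite !mxE.
exact: leq_trans (mxrankM_maxl _ _) (rank_leq_col _).
Qed.

(** The matrix of determinants is diagonal and invertible, so its rank is [m], while the expansion
    bounds this rank by the number of terms. *)
Lemma induced_matching_leq (K : fieldType) (k m : nat) (a b : 'I_m -> 'M[K]_k) :
  (forall i j, (\det (a i + b j) != 0) = (i == j)) -> (m <= k`! * 2 ^ k)%N.
Proof.
move=> ab; set D := \matrix_(i < m, j < m) \det (a i + b j).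
have D_diag : D = diag_mx (\row_i \det (a i + b i)).
  apply/matrixP => i j; rewrite !mxE; case: eqVneq => [->|ij] //=.
  by apply/eqP; rewrite mulr0n -[_ == _]negbK ab.
have D_unit : D \in unitmx.
  rewrite unitmxE D_diag det_diag unitfE; apply/prodf_neq0 => i _.
  by rewrite mxE ab.
rewrite -(mxrank_unit D_unit) {D_diag D_unit}.
have -> : D = \matrix_(i, j)
    \sum_(t : {perm 'I_k} * {ffun 'I_k -> bool})
      ((-1) ^+ t.1 * \prod_l (if t.2 l then a i l (t.1 l) else 1)) *
      \prod_l (if t.2 l then 1 else b j l (t.1 l)).
  by apply/matrixP => i j; rewrite !mxE det_addE.
apply: leq_trans (mxrank_sum_mul _ _ _ _ _ _) _.
by rewrite card_prod card_Sn card_ffun card_bool card_ord.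
Qed.

(** Remove a maximal independent set [J] and induct: each removal destroys at least [#|S|] related
    pairs and at most [r] points. As [e] may be asymmetric, independence forbids both directions. *)
Lemma card_rel_independent (I : finType) (e : rel I) (r : nat) :
  reflexive e ->
  (forall J : {set I}, {in J &, forall i j, e i j = (i == j)} -> (#|J| <= r)%N) ->
  forall S : {set I},
    (#|S| ^ 2 <= 2 * r * #|[set p in setX S S | e p.1 p.2]|)%N.
Proof.
move=> erefl ind S; have [m] := ubnP #|S|; elim: m S => // m IHm S lt_Sm.
have [->|S_neq0] := eqVneq S set0; first by rewrite cards0.
pose indep (J : {set I}) :=
  (J \subset S) && [forall i in J, forall j in J, e i j == (i == j)].
have indep0 : indep set0.
  by rewrite /indep sub0set; apply/forall_inP => i; rewrite inE.
have [J /maxsetP[/andP[sJS /forall_inP J_ind] J_max] _] := maxset_exists indep0.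
have le_Jr : (#|J| <= r)%N.
  apply: ind => i j iJ jJ; apply/eqP.
  by move/forall_inP: (J_ind i iJ); apply.
(* Otherwise [x |: J] would be independent, against maximality. *)
have meetJ x : x \in S -> x \notin J -> exists2 y, y \in J & e x y || e y x.
  move=> xS xJ; apply/exists_inP; apply: contraNT xJ => /exists_inPn noy.
  rewrite -(J_max (x |: J)) ?setU11 ?subsetUr //.
  rewrite /indep subUset sub1set xS sJS; apply/forall_inP => i iJ.
  apply/forall_inP => j; move: iJ; rewrite !inE.
  have neq y : y \in J -> ((x == y) = false) * ((e x y = false) * (e y x = false)).
    move=> yJ; have := noy y yJ; rewrite negb_or => /andP[/negbTE-> /negbTE->].
    split=> //; apply/negbTE; apply: contraTneq (noy y yJ) => ->.
    by rewrite erefl.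
  case/predU1P=> [->|iJ] /predU1P[->|jJ].
  - by rewrite erefl eqxx.
  - by rewrite !(neq j).
  - by rewrite eq_sym [i == x]eq_sym !(neq i).
  - by move/forall_inP: (J_ind i iJ); apply.
pose N (X : {set I}) := [set p in setX X X | e p.1 p.2].
(* On a pair with one endpoint in [J], [v] returns the other one; points of [J] are reached from
   diagonal pairs. Hence the destroyed pairs map onto [S]. *)
pose v (p : I * I) := if p.1 \in J then p.2 else p.1.
have S_img : S \subset v @: (N S :\: N (S :\: J)).
  apply/subsetP => x xS; apply/imsetP.
  have [xJ|xJ] := boolP (x \in J).
    by exists (x, x); rewrite /v /= ?xJ // !inE /= xS xJ erefl.
  have [y yJ /orP[exy|eyx]] := meetJ x xS xJ; have yS := subsetP sJS y yJ.
    by exists (x, y); rewrite /v /= ?(negbTE xJ) // !inE /= xS yS yJ exy andbF.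
  by exists (y, x); rewrite /v /= ?yJ // !inE /= xS yS yJ eyx.
have sNN : N (S :\: J) \subset N S.
  apply/subsetP => -[x y]; rewrite !inE /=.
  by move=> /andP[/andP[/andP[_ ->] /andP[_ ->]]].
have cN : (#|S| + #|N (S :\: J)| <= #|N S|)%N.
  rewrite -(cardsID (N (S :\: J)) (N S)) (setIidPr sNN) addnC leq_add2l.
  exact: leq_trans (subset_leq_card S_img) (leq_imset_card _ _).
have J_gt0 : (0 < #|J|)%N.
  rewrite card_gt0; apply: contraNneq S_neq0 => J0; apply/eqP/setP => x.
  rewrite in_set0; apply/negP => xS.
  by have [|y] := meetJ x xS; rewrite J0 inE.
have cSJ : #|S| = (#|J| + #|S :\: J|)%N.
  by rewrite -(cardsID J S) (setIidPr sJS).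
have lt_SJ : (#|S :\: J| < m)%N by lia.
have := IHm _ lt_SJ; rewrite -/(N _) -/(N S).
(* With [s = j + t], one has [s^2 - t^2 = j * (s + t) <= 2 * r * s], and [s] pairs are lost. *)
move: cN cSJ le_Jr; move: #|S| #|J| #|S :\: J| #|N _| #|N _| => s j t N' N1.
nia.
Qed.

Theorem theorem2 (R : realType) (k : nat) (hk : (0 < k)%N) :
  exists c : R, 0 < c /\
    forall (K : fieldType) (n : nat) (M1 M2 : {fset 'M[K]_k}),
      2%N \notin [pchar K] -> (0 < n)%N ->
      #|` M1| = n -> #|` M2| = n ->
      (exists S : {set {set det_vertex M1 M2}},
          matching (det_graph M1 M2) S /\ #|S| = n) ->
      c * n%:R ^+ 2 <= #|edges (det_graph M1 M2)|%:R.
Proof.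
pose r := (k`! * 2 ^ k)%N.
have r_gt0 : 0 < (2 * r)%:R :> R.
  by rewrite ltr0n !muln_gt0 fact_gt0 expn_gt0.
exists (2 * r)%:R^-1; split; first by rewrite invr_gt0.
move=> K n M1 M2 _ _ _ _ [S [/andP[/subsetP sS /trivIsetP tS] cS]].
rewrite mulrC ler_pdivrMr // -natrX -natrM ler_nat mulnC.
(* [p E] lists the endpoints of the matching edge [E], the one in [M1] first. *)
have [E|p pP] := @fin_all_exists {E | E \in S} (fun=> (M1 * M2)%type)
    (fun E q => val E = [set inl q.1; inr q.2] /\
      \det (fsval q.1 + fsval q.2) != 0).
  have /imsetP[[[A|B] [A'|B']] //= AB ->] := sS _ (valP E).
    by exists (A, B').
  by exists (A', B); rewrite setUC.
(* Distinct matching edges are disjoint, so one endpoint determines the edge. *)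
have pinj E E' : (p E).1 = (p E').1 \/ (p E).2 = (p E').2 -> E = E'.
  have [EE _] := pP E; have [EE' _] := pP E'.
  move=> pE; apply: val_inj; apply: contraTeq isT => /= neqE.
  have := tS _ _ (valP E) (valP E') neqE; rewrite EE EE' => dis.
  case: pE => pE.
    by have := disjointFr dis (set21 _ _); rewrite pE set21.
  by have := disjointFr dis (set22 _ _); rewrite pE set22.
pose e (E E' : {E | E \in S}) := \det (fsval (p E).1 + fsval (p E').2) != 0.
have e_refl : reflexive e by move=> E; case: (pP E).
have ind (J : {set {E | E \in S}}) :
    {in J &, forall i j, e i j = (i == j)} -> (#|J| <= r)%N.
  move=> J_ind; apply: (@induced_matching_leq K k #|J|
    (fun i => fsval (p (enum_val i)).1) (fun i => fsval (p (enum_val i)).2)).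
  move=> i j; rewrite -(inj_eq enum_val_inj).
  exact: J_ind (enum_valP i) (enum_valP j).
have := card_rel_independent _ _ _ e_refl ind [set: _].
rewrite cardsT card_sig cS => /leq_trans; apply.
rewrite leq_mul2l; apply/orP; right.
(* Ordered pairs related by [e] inject into the edges: the tags [inl] and [inr] recover the
   order. *)
pose h (q : {E | E \in S} * {E | E \in S}) : {set det_vertex M1 M2} :=
  [set inl (p q.1).1; inr (p q.2).2].
have h_inj : injective h.
  move=> [E1 E2] [F1 F2]; rewrite /h /= => hEF.
  have := set21 (inl (p E1).1 : det_vertex M1 M2) (inr (p E2).2).
  rewrite hEF !inE orbF => /eqP[/or_introl/pinj->].
  have := set22 (inl (p E1).1 : det_vertex M1 M2) (inr (p E2).2).
  by rewrite hEF !inE /= => /eqP[/or_intror/pinj->].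
rewrite -(card_imset _ h_inj); apply: subset_leq_card.
apply/subsetP => _ /imsetP[[E E'] /[!inE] /= eE ->].
by apply/imsetP; exists (inl (p E).1, inr (p E').2).
Qed.
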